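(* Let $K/\mathbb{Q}$ be any number field of degree $n\geq 2$ with ring of integers $\mathcal{O}_K$, and in which a fixed prime integer $p\geq 3$ is inert. For $c\in\mathcal{O}_K$ let $\varphi_{p,c}$ be the polynomial map defined by $\varphi_{p,c}(z)=z^p+c$ for all $z\in\mathcal{O}_K$. Then for every $c\in\mathcal{O}_K$ the number of distinct integral fixed points of $\varphi_{p,c}$ modulo $p\mathcal{O}_K$ is either $p$ or $0$.
   Context: The number of distinct integral fixed points of $\varphi_{p,c}$ modulo $p\mathcal{O}_K$ means $\#\{z\in\mathcal{O}_K/p\mathcal{O}_K : \varphi_{p,c}(z)-z\equiv 0 \pmod{p\mathcal{O}_K}\}$. The prime $p$ is inert in $K$ if $p\mathcal{O}_K$ is a prime ideal of $\mathcal{O}_K$. *)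

(* Defs.v *)
From HB Require Import structures.
From mathcomp Require Import all_boot all_order all_algebra all_field.
From mathcomp Require Import ring_quotient.
From mathcomp Require Import boolp classical_sets functions cardinality.

Set Implicit Arguments.
Unset Strict Implicit.
Unset Printing Implicit Defensive.

Import Order.TTheory GRing.Theory Num.Theory.
Local Open Scope ring_scope.
Local Open Scope quotient_scope.
Local Open Scope classical_set_scope.

Section RingOfIntegers.
Variable K : fieldExtType rat.

Definition algint : {pred K} :=
  [pred x | `[< integralOver (intr : int -> K) x >]].

Lemma algintP x : reflect (integralOver (intr : int -> K) x) (x \in algint).
Proof. exact: asboolP. Qed.

Lemma algint_subring : subring_closed algint.
Proof.
split=> [|x y /algintP hx /algintP hy|x y /algintP hx /algintP hy];
  apply/algintP.
- exact: integral1.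
- exact: integral_sub.
- exact: integral_mul.
Qed.

HB.instance Definition _ := GRing.isSubringClosed.Build K algint algint_subring.

Definition OK := {x : K | x \in algint}.

HB.instance Definition _ := SubChoice.on OK.
HB.instance Definition _ := [SubChoice_isSubComNzRing of OK by <:].

End RingOfIntegers.

(* A unit fraction 1/p with p > 1 is not integral, so p is not a unit of O_K. *)
Lemma OK_prime_nunit (K : fieldExtType rat) (p : nat) (hp : prime p) (y : OK K) :
  1 <> p%:R * y.
Proof.
move=> /(congr1 (val : OK K -> K)); rewrite rmorphM rmorph1 rmorph_nat => e1.
have /algintP[q mq /rootP q0] := valP y; set z : K := val y in e1 q0.
have char0 (m : int) : (m%:~R == 0 :> K) = (m == 0).
  rewrite -(rmorph_int (in_alg K)) fmorph_eq0; exact: intr_eq0.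
pose d := (size q).-1.
have sq : size q = d.+1 by rewrite prednK // lt0n size_poly_eq0 monic_neq0.
have /eqP : (\sum_(i < d.+1) q`_i * p%:Z ^+ (d - i))%:~R = 0 :> K.
  transitivity (p%:R ^+ d * (map_poly intr q).[z]); last by rewrite q0 mulr0.
  rewrite horner_coef size_map_inj_poly ?rmorph0 //;
    last by move=> a b /eqP; rewrite -subr_eq0 -rmorphB char0 subr_eq0 => /eqP.
  rewrite sq rmorph_sum mulr_sumr; apply: eq_bigr => i _.
  rewrite coef_map rmorphM rmorphXn /= mulrCA; congr (_ * _).
  have id : (i <= d)%N by rewrite -ltnS.
  have -> : p%:R ^+ d = p%:R ^+ (d - i) * p%:R ^+ i :> K.
    by rewrite -exprD subnK.
  by rewrite -mulrA -exprMn -e1 expr1n mulr1.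
rewrite char0 big_ord_recr /= subnn expr0 mulr1.
have -> : q`_d = 1 by move: mq; rewrite monicE lead_coefE => /eqP.
rewrite addrC addr_eq0 => /eqP e.
have : (p%:Z %| 1%R)%Z.
  rewrite e rpredN; apply: rpred_sum => i _.
  apply: dvdz_mull; by rewrite -(subnSK (ltn_ord i)) exprS dvdz_mulr.
by rewrite dvdzE /= dvdn1 => /eqP p1; rewrite p1 in hp.
Qed.

(* The ideal p O_K. Membership does not depend on the primality proof, which
   only serves to make p O_K proper, as ideal quotients require. *)
Section PrimeIdeal.
Variables (K : fieldExtType rat) (p : nat) (hp : prime p).

Definition pOK of prime p : {pred OK K} :=
  [pred x | `[< exists y : OK K, x = p%:R * y >]].

Lemma pOKP x : reflect (exists y : OK K, x = p%:R * y) (x \in pOK hp).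
Proof. exact: asboolP. Qed.

Lemma pOK_idealr_closed : idealr_closed (pOK hp).
Proof.
split=> [||a _ _ /pOKP[u ->] /pOKP[v ->]].
- by apply/pOKP; exists 0; rewrite mulr0.
- by apply/pOKP => -[y]; apply: OK_prime_nunit.
- by apply/pOKP; exists (a * u + v); rewrite mulrDr mulrCA.
Qed.

HB.instance Definition _ := isIdealr.Build (OK K) (pOK hp) pOK_idealr_closed.

Definition inert : Prop := idealr_closed (pOK hp) /\ prime_idealr_closed (pOK hp).

End PrimeIdeal.

Arguments pOK K {p} hp.
Arguments inert K {p} hp.

Definition phi (R : comNzRingType) (p : nat) (c z : R) : R := z ^+ p + c.

(* The solutions z in O_K / p O_K of phi_{p,c}(z) - z = 0, the polynomial map
   phi_{p,c} acting on the quotient ring through the class of c. *)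
Definition fixed_points_mod (K : fieldExtType rat) (p : nat) (hp : prime p)
    (c : OK K) : set {ideal_quot pOK K hp} :=
  [set z | phi p (\pi_{ideal_quot pOK K hp} c) z - z = 0].

Arguments fixed_points_mod {K p} hp c.

Lemma fixed_points_modE (K : fieldExtType rat) (p : nat) (hp : prime p)
    (c x : OK K) :
  fixed_points_mod hp c (\pi x) <-> phi p c x - x \in pOK K hp.
Proof.
rewrite /fixed_points_mod /= /phi -rmorphXn -rmorphD -rmorphB.
rewrite -[X in X \in _]subr0 Quotient.idealrBE rmorph0.
by split=> /eqP.
Qed.

(* Main.v *)
Require Import Defs.
From HB Require Import structures.
From mathcomp Require Import all_boot all_order all_algebra all_field.
From mathcomp Require Import ring_quotient.
From mathcomp Require Import boolp classical_sets functions cardinality.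

Set Implicit Arguments.
Unset Strict Implicit.
Unset Printing Implicit Defensive.

Import Order.TTheory GRing.Theory Num.Theory.
Local Open Scope ring_scope.
Local Open Scope card_scope.

(** In [O_K / p O_K] the equation to solve is [z ^ p - z = - c].  This quotient
    has characteristic [p], so [z |-> z ^ p - z] is additive there and the
    solutions are either absent or form a coset of its kernel, the roots of
    [X ^ p - X].  That kernel contains the prime field, of [p] elements.
    Inertness makes the quotient an integral domain, and
    [X ^ p - X = \prod_(a in F_p) (X - a)] then shows that the kernel contains
    nothing else ([pFrobenius_fixed]).  Hence there are [p] solutions or none
    ([card_fixed_points_pchar]).

    The zero-product property is carried as an explicit hypothesis [integral],
    because the quotient ring is defined for every prime [p] and has this
    property only when [p] is inert. *)

Section PrimeCharacteristic.
Variables (R : comNzRingType) (p : nat) (pcharRp : p \in [pchar R]).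

(** [R] is an algebra over its prime field, so the factorization of
    [X ^ p - X] over ['F_p] can be transported to [R] and evaluated. *)
Lemma prod_sub_Fp (x : R) : \prod_(a : 'F_p) (x - (a : nat)%:R) = x ^+ p - x.
Proof.
have p_pr := pcharf_prime pcharRp.
have iota : {rmorphism 'F_p -> pPrimeCharType pcharRp} := in_alg _.
have iotaE a : iota a = (a : nat)%:R by rewrite -{1}[a]natr_Zp rmorph_nat.
have /(congr1 (fun q => (map_poly iota q).[x : pPrimeCharType pcharRp])) :=
  finField_genPoly 'F_p.
rewrite card_Fp // rmorphB /= map_polyXn map_polyX !hornerE => ->.
rewrite rmorph_prod horner_prod; apply: eq_bigr => a _.
by rewrite rmorphB /= map_polyX map_polyC !hornerE /= iotaE.
Qed.

Lemma natr_pchar_inj : {in `I_p &, injective (fun k => k%:R : R)}.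
Proof.
move=> i j /set_mem /= ip /set_mem /= jp.
wlog le_ij : i j ip jp / (i <= j)%N => [hw eq_ij|].
  by case/orP: (leq_total i j) => /hw; [apply|move=> ->].
move=> /eqP; rewrite eq_sym -subr_eq0 -natrB // -(dvdn_pcharf pcharRp).
rewrite /dvdn modn_small ?(leq_ltn_trans (leq_subr _ _)) // subn_eq0 => le_ji.
by apply/eqP; rewrite eqn_leq le_ij.
Qed.

Hypothesis integral : forall x y : R, x * y = 0 -> (x == 0) || (y == 0).

Lemma pFrobenius_fixed (x : R) : x ^+ p = x -> exists2 k, (k < p)%N & x = k%:R.
Proof.
have p_pr := pcharf_prime pcharRp.
move=> /eqP; rewrite -subr_eq0 -prod_sub_Fp => /eqP prod0.
have [a /eqP xa] : exists a : 'F_p, x - (a : nat)%:R == 0.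
  apply/existsP; apply: contra_eqT prod0 => /existsPn nz.
  elim/big_ind: _ => [|u v nzu nzv|a _]; [exact: oner_neq0| |exact: nz].
  by apply/eqP => /integral; rewrite (negPf nzu) (negPf nzv).
exists a; last by apply/eqP; rewrite -subr_eq0 xa.
by rewrite -[X in (_ < X)%N](Fp_cast p_pr).
Qed.

(** A translate by a solution [z0] identifies all solutions with those of
    [w ^ p = w], that is, with the multiples [0, ..., p - 1] of [1]. *)
Lemma card_fixed_points_pchar (c : R) :
  let S := [set z | phi p c z - z = 0]%classic in S #= `I_p \/ S #= `I_0.
Proof.
move=> S; have [[z0 /= Sz0]|S0] := pselect (exists z, S z); last first.
  right; rewrite (_ : S = set0) ?II0 ?card_eqxx //.
  by rewrite -subset0 => z Sz; case: S0; exists z.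
left; have frobD (x y : R) : (x + y) ^+ p = x ^+ p + y ^+ p.
  by have := pFrobenius_autD_comm pcharRp (mulrC x y); rewrite !pFrobenius_autE.
have Sadd w : phi p c (z0 + w) - (z0 + w) = w ^+ p - w.
  by rewrite -[RHS]add0r -Sz0 opprD [RHS]addrACA /phi frobD
    [z0 ^+ p + c + _]addrAC.
rewrite (_ : S = ((fun k => z0 + k%:R) @` `I_p)%classic).
  by apply: inj_card_eq => i j ip jp /addrI; exact: natr_pchar_inj.
apply/seteqP; split=> [z Sz|_ [k _ <-]]; last first.
  by rewrite /S /= Sadd -(pFrobenius_autE pcharRp) pFrobenius_aut_nat subrr.
have : (z - z0) ^+ p = z - z0.
  by apply/eqP; rewrite -subr_eq0 -Sadd [z0 + _]addrC subrK; apply/eqP.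
by case/pFrobenius_fixed=> k kp zE; exists k => //; rewrite -zE addrC subrK.
Qed.

End PrimeCharacteristic.

Section ResidueRing.
Variables (K : fieldExtType rat) (p : nat) (hp : prime p).
Local Notation Okp := {ideal_quot pOK K hp}.

Lemma pchar_quot_pOK : p \in [pchar Okp].
Proof.
rewrite inE hp /= -(rmorph_nat (\pi_Okp)%qT) -(rmorph0 (\pi_Okp)%qT).
by rewrite -Quotient.idealrBE subr0; apply/pOKP; exists 1; rewrite mulr1.
Qed.

Lemma integral_quot_pOK : inert K hp ->
  forall x y : Okp, x * y = 0 -> (x == 0) || (y == 0).
Proof.
case=> _ primeI x y; rewrite -[x]reprK -[y]reprK -rmorphM => /eqP.
rewrite -(rmorph0 (\pi_Okp)%qT) -!Quotient.idealrBE !subr0.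
exact: primeI.
Qed.

End ResidueRing.

Theorem theorem1p1 (K : fieldExtType rat) (n : nat)
    (hdeg : \dim {:K} = n) (hn : (2 <= n)%N)
    (p : nat) (hp : prime p) (hp3 : (3 <= p)%N) (hinert : inert K hp)
    (c : OK K) :
  fixed_points_mod hp c #= `I_p \/ fixed_points_mod hp c #= `I_0.
Proof.
exact: card_fixed_points_pchar (pchar_quot_pOK K hp) (integral_quot_pOK hinert)
  (\pi_{ideal_quot pOK K hp} c)%qT.
Qed.
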